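(* There exist absolute constants $x_0$ and $c>0$ such that the following holds for all $x\ge x_0$. Let $(a(n))$, $\mathcal A$, $\mathcal S$, $h$, $f_q$, $\gamma_q$ be as in the context, and suppose that $\mathcal S\subset[1,\log\log x]$ and that $0\le h(n)\le1$ for all $n$. Suppose that $$\sum_{p\le\log x}\frac{1-h(p)}{p}\log p\ \ge\ \alpha\log\log x$$ for some $\alpha\ge 60\log\log\log x/\log\log x$, and set $\eta=\min(\alpha/3,1/100)$. Then for each real $u$ with $5/\eta^2\le u\le\eta(\log x)^{\eta/2}$ there exist $y\in(x/4,x)$ and an arithmetic progression $a\pmod\ell$ with $\ell\le x/(\log x)^u$ and $(\ell,\mathcal S)=1$ such that $$\Big|\mathcal A(y;\ell,a)-\frac{f_\ell(a)}{\ell\gamma_\ell}\,y\,\frac{\mathcal A(x)}{x}\Big|\ \ge\ c\,\exp\Big(-\frac u\eta(1+25\eta)\log(2u/\eta^3)\Big)\frac{\mathcal A(x)}{\phi(\ell)}.$$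
   Context: $(a(n))_{n\ge1}$ is a sequence of non-negative real numbers, $\mathcal A(x)=\sum_{n\le x}a(n)$ and $\mathcal A(x;q,a)=\sum_{n\le x,\ n\equiv a\,(\mathrm{mod}\ q)}a(n)$. $\mathcal S$ is a finite set of primes, and $(q,\mathcal S)=1$ means that no prime of $\mathcal S$ divides $q$. $h$ is a non-negative real-valued multiplicative function. For a positive integer $q$ put $$\gamma_q=\prod_{p\mid q}\Big(\frac{1-h(p)/p}{1-1/p}\Big)^{-1}.$$ $f_q$ is the multiplicative function defined as follows: $f_q(p^k)=1$ if $p\nmid q$; if $p^e$ (with $e\ge1$) is the exact power of $p$ dividing $q$, then $$f_q(p^k)=\Big(h(p^k)-\frac{h(p^{k+1})}{p}\Big)\Big(1-\frac{h(p)}p\Big)^{-1}\ \text{ if }k<e,\qquad f_q(p^k)=h(p^e)\Big(1-\frac1p\Big)\Big(1-\frac{h(p)}p\Big)^{-1}\ \text{ if }k\ge e.$$ Thus $f_q(a)=f_q((a,q))$, and this extends $f_q$ to all integers $a$ (with $f_q(0)=f_q(q)$). Sums and products over $p$ run over primes; $\phi$ is Euler's totient function. *)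

(* Defs.v *)
From mathcomp Require Import all_boot all_order all_algebra.
From mathcomp Require Import finmap.
From mathcomp Require Import all_classical all_reals all_analysis.

Set Implicit Arguments.
Unset Strict Implicit.
Unset Printing Implicit Defensive.

Import Order.TTheory GRing.Theory Num.Theory.
Local Open Scope ring_scope.

(* Arithmetic functions and sequences indexed by n >= 1 are functions on nat
   whose value at 0 is never constrained or used. *)

Definition arith_multiplicative (R : realType) (h : nat -> R) : Prop :=
  h 1%N = 1 /\
  forall m n : nat, (0 < m)%N -> (0 < n)%N -> coprime m n ->
    h (m * n)%N = h m * h n.

(* For x >= 1, Num.truncn x is the integer part of x; it is 0 for x < 1. *)
Definition summatory (R : realType) (a : nat -> R) (x : R) : R :=
  \sum_(1 <= n < (Num.truncn x).+1) a n.

Definition summatory_ap (R : realType) (a : nat -> R) (x : R)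
    (q : nat) (b : int) : R :=
  \sum_(1 <= n < (Num.truncn x).+1 | (n%:Z == b %[mod q%:Z])%Z) a n.

Definition gamma_ (R : realType) (h : nat -> R) (q : nat) : R :=
  \prod_(p <- primes q) ((1 - h p / p%:R) / (1 - 1 / p%:R))^-1.

Definition f_local (R : realType) (h : nat -> R) (q p k : nat) : R :=
  if (p %| q)%N then
    let e := logn p q in
    if (k < e)%N then
      (h (p ^ k)%N - h (p ^ k.+1)%N / p%:R) * (1 - h p / p%:R)^-1
    else h (p ^ e)%N * (1 - 1 / p%:R) * (1 - h p / p%:R)^-1
  else 1.

Definition f_ (R : realType) (h : nat -> R) (q n : nat) : R :=
  \prod_(p <- primes n) f_local h q p (logn p n).

(* The extension of f_ h q to all integers, through f_q(b) = f_q((b, q));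
   since gcdn 0 q = q, its value at 0 is f_q(q). *)
Definition f_int (R : realType) (h : nat -> R) (q : nat) (b : int) : R :=
  f_ h q (gcdn `|b|%N q).

Lemma f_prime_power (R : realType) (h : nat -> R) (q p k : nat) :
  prime p -> (0 < k)%N -> f_ h q (p ^ k)%N = f_local h q p k.
Proof.
move=> pp k0; rewrite /f_ primesX // primes_prime // big_seq1.
by rewrite pfactorK.
Qed.

Lemma f_int_pos (R : realType) (h : nat -> R) (q n : nat) :
  (0 < q)%N -> (0 < n)%N -> f_int h q n%:Z = f_ h q n.
Proof.
move=> q0 n0; rewrite /f_int absz_nat /f_.
have g0 : (0 < gcdn n q)%N by rewrite gcdn_gt0 n0.
have -> : primes (gcdn n q) = [seq p <- primes n | (p %| q)%N].
  apply: (irr_sorted_eq ltn_trans ltnn).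
  - exact: sorted_primes.
  - exact: (sorted_filter ltn_trans _ (sorted_primes n)).
  - move=> p; rewrite mem_filter !mem_primes g0 n0 dvdn_gcd /=.
    by case: (prime p); rewrite /= ?andbF // andbC.
rewrite big_filter [RHS](bigID (fun p => (p %| q)%N)) /=.
rewrite [X in _ * X]big1 ?mulr1; last first.
  by move=> p /negbTE; rewrite /f_local => ->.
apply: eq_bigr => p pq.
rewrite /f_local pq logn_gcd // gtn_min ltnn orbF.
by case: ltnP => // ne; rewrite (minn_idPl (ltnW ne)).
Qed.

(* Main.v *)
(** Fix a prime [r], a power [l = r ^ m] slightly below [x / (log x) ^ u], and
    let [q] be a product of primes of [((log x) ^ eta, (log x) / 4]] other than
    [r].  Summing [a] over the matrix [q (1 + r rho) + s l] by rows
    (progressions modulo [l]) and by columns (progressions modulo [q r]) shows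
    that, if all these progressions were well distributed, then
    [sum_(s <= M) (f_q s - gamma_q)] would be tiny compared with [M], where
    [M] is about [x / (4 l)].
    To contradict this, split the available primes into [k ~ u / eta] blocks
    of comparable weight [sum (1 - h p) / p] and let [q_I] be the product of
    the primes in the blocks [i \in I].  By multiplicativity, the alternating
    sum of [f_(q_I) s] over all sets [I] of blocks is
    [prod_i (1 - f_(q_i) s)], which vanishes for every [s <= M] because [s] is
    too small to have a prime factor in each block.  Hence the product
    [prod_i (1 - gamma_(q_i))] would be tiny, whereas each factor is at least
    half the threshold weight of its block. *)

Require Import Defs.
From mathcomp Require Import all_boot all_order all_algebra.
From mathcomp Require Import finmap.
From mathcomp Require Import all_classical all_reals all_analysis.
From mathcomp Require Import ring lra zify.

Set Implicit Arguments.
Unset Strict Implicit.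
Unset Printing Implicit Defensive.

Import Order.TTheory GRing.Theory Num.Theory.
Local Open Scope ring_scope.

(** * Elementary prime number estimates *)

Lemma coprime_prod_primes (p : nat) (s : seq nat) :
  prime p -> all prime s -> p \notin s -> coprime p (\prod_(t <- s) t).
Proof.
move=> pp aps ps; rewrite prime_coprime // Euclid_dvd_prod // big_has.
apply/hasPn => t ts /=; rewrite dvdn_prime2 //; last exact: (allP aps).
by apply: contra ps => /eqP ->.
Qed.

Lemma prod_primes_dvdn (s : seq nat) (N : nat) :
  uniq s -> all prime s -> (forall p, p \in s -> (p %| N)%N) ->
  (\prod_(p <- s) p %| N)%N.
Proof.
elim: s => [|p s IH] /=; first by rewrite big_nil dvd1n.
move=> /andP[ps us] /andP[pp aps] H; rewrite big_cons Gauss_dvd.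
  by rewrite H ?inE ?eqxx //= IH // => t ts; rewrite H // inE ts orbT.
exact: coprime_prod_primes.
Qed.

Lemma prime_dvd_fact (p n : nat) : prime p -> (p %| n`!)%N = (p <= n)%N.
Proof.
move=> pp; apply/idP/idP; last by move=> pn; rewrite dvdn_fact // prime_gt0.
elim: n => [|n IH]; first by rewrite fact0 Euclid_dvd1.
rewrite factS Euclid_dvdM // => /orP[/dvdn_leq -> //|/IH]; exact: leqW.
Qed.

(** The two middle coefficients of row [2m + 1] are equal, and their sum is at most the row sum
    [2 ^ (2m + 1)]. *)
Lemma bin_middle_le (m : nat) : ('C(m.*2.+1, m) <= 4 ^ m)%N.
Proof.
have E : 'C(m.*2.+1, m.+1) = 'C(m.*2.+1, m).
  rewrite -[LHS]bin_sub; first by congr binomial; lia.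
  lia.
have : ('C(m.*2.+1, m) + 'C(m.*2.+1, m.+1) <= 2 ^ m.*2.+1)%N.
  have H1 : (m < m.*2.+2)%N by lia.
  have H2 : (m.+1 < m.*2.+2)%N by lia.
  have := Pascal 1 1 m.*2.+1; rewrite addn1 => ->.
  rewrite (bigD1 (Ordinal H1)) //= (bigD1 (Ordinal H2)) //=; last first.
    by rewrite -val_eqE /=; lia.
  by rewrite !exp1n !muln1 addnA leq_addr.
by rewrite E addnn -mul2n expnS leq_pmul2l // -mul2n expnM.
Qed.

(** Strong induction in the style of Erdos: an even [n > 2] adds no prime, and for [n = 2m + 1] the
    primes of [(m + 1, 2m + 1]] all divide the middle binomial coefficient, which is at most
    [4 ^ m]. *)
Lemma primorial_le (n : nat) :
  (\prod_(1 <= p < n.+1 | prime p) p <= 4 ^ n)%N.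
Proof.
have [N le_nN] := ubnP n; elim: N n le_nN => // N IH n; rewrite ltnS => le_nN.
case: (leqP n 2) => [|n2].
  by case: n le_nN => [|[|[|]]] // _ _; rewrite unlock.
case: (boolP (odd n)) => on; last first.
  have np : ~~ prime n.
    by apply/negP => pn; case: (even_prime pn) => [E|/idP E]; move: n2 on; rewrite ?E.
  rewrite big_mkcond big_nat_recr /=; last by lia.
  rewrite (negbTE np) muln1 -big_mkcond /=.
  case: n n2 le_nN {on np} => // n n2 le_nN.
  by apply: (leq_trans (IH n _)); rewrite ?leq_exp2l //; lia.
set m := n./2; have En : n = m.*2.+1 by rewrite -[LHS]odd_double_half on.
rewrite En (big_cat_nat _ (n := m.+2)) //=; last by lia.
have -> : (4 ^ m.*2.+1 = 4 ^ m.+1 * 4 ^ m)%N by rewrite -expnD; congr expn; lia.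
apply: leq_mul; first by apply: IH; lia.
apply: leq_trans (bin_middle_le m); apply: dvdn_leq; first by rewrite bin_gt0; lia.
rewrite -big_filter; apply: prod_primes_dvdn.
- exact/filter_uniq/iota_uniq.
- by apply/allP => p; rewrite mem_filter => /andP[].
move=> p; rewrite mem_filter mem_index_iota => /andP[pp /andP[p1 p2]].
have : (p %| m.*2.+1`!)%N by rewrite prime_dvd_fact //; lia.
rewrite -(@bin_fact _ m); last by lia.
rewrite !Euclid_dvdM // !prime_dvd_fact // => /orP[//|/orP[]]; lia.
Qed.

Lemma sum_ln_primes_le (R : realType) (n : nat) :
  \sum_(1 <= p < n.+1 | prime p) ln (p%:R : R) <= n%:R * ln 4.
Proof.
have -> : \sum_(1 <= p < n.+1 | prime p) ln (p%:R : R) =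
    ln ((\prod_(1 <= p < n.+1 | prime p) p)%N%:R : R).
  have H (s : seq nat) : \sum_(p <- s | prime p) ln (p%:R : R) =
      ln ((\prod_(p <- s | prime p) p)%N%:R) /\
      (0 < \prod_(p <- s | prime p) p)%N.
    elim: s => [|p s [IH1 IH2]]; first by rewrite !big_nil ln1.
    rewrite !big_cons; case: ifP => // pp; split.
      by rewrite IH1 natrM lnM // posrE ltr0n // prime_gt0.
    by rewrite muln_gt0 prime_gt0.
  exact: (proj1 (H _)).
have p0 : (0 < \prod_(1 <= p < n.+1 | prime p) p)%N.
  by rewrite prodn_cond_gt0 // => p; exact: prime_gt0.
rewrite mulr_natl -lnXn; last by rewrite ltr0n.
rewrite ler_ln ?posrE ?exprn_gt0 ?ltr0n // -natrX ler_nat.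
exact: primorial_le.
Qed.

(* Compares [n!] with its divisor [prod_(p <= n) p ^ (n %/ p)]; the bound
   [n / (2 p) <= n %/ p] costs a factor 2 but removes any error term. *)
Lemma sum_ln_primes_div_le (R : realType) (n : nat) :
  \sum_(1 <= p < n.+1 | prime p) ln (p%:R : R) / p%:R <= 2 * ln n%:R.
Proof.
case: n => [|n]; first by rewrite big_geq // ln0 ?mulr0.
set N := n.+1.
have L : \sum_(1 <= p < N.+1 | prime p) (N %/ p)%:R * ln (p%:R : R) <=
   ln (N`!%:R : R).
  have -> : \sum_(1 <= p < N.+1 | prime p) (N %/ p)%:R * ln (p%:R : R) =
      ln ((\prod_(1 <= p < N.+1 | prime p) p ^ (N %/ p))%N%:R : R).
    have H (s : seq nat) : \sum_(p <- s | prime p) (N %/ p)%:R * ln (p%:R : R) =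
        ln ((\prod_(p <- s | prime p) p ^ (N %/ p))%N%:R) /\
        (0 < \prod_(p <- s | prime p) p ^ (N %/ p))%N.
      elim: s => [|p s [IH1 IH2]]; first by rewrite !big_nil ln1.
      rewrite !big_cons; case: ifP => // pp; split.
        rewrite IH1 natrM lnM; [|rewrite posrE ltr0n expn_gt0 prime_gt0 //|by rewrite posrE ltr0n].
        by rewrite natrX lnXn ?ltr0n ?prime_gt0 // mulr_natl.
      by rewrite muln_gt0 expn_gt0 prime_gt0.
    exact: (proj1 (H _)).
  have p0 : (0 < \prod_(1 <= p < N.+1 | prime p) p ^ (N %/ p))%N.
    by rewrite prodn_cond_gt0 // => p pp; rewrite expn_gt0 prime_gt0.
  rewrite ler_ln ?posrE ?ltr0n ?fact_gt0 // ler_nat.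
  apply: (@leq_trans (\prod_(1 <= p < N.+1 | prime p) p ^ logn p N`!)).
    rewrite big_nat_cond [X in (_ <= X)%N]big_nat_cond.
    apply: leq_prod => p /andP[/andP[p1 pN] pp].
    rewrite leq_exp2l ?prime_gt1 // logn_fact // big_nat_recl //.
    by rewrite expn1 leq_addr.
  rewrite [X in (_ <= X)%N](prod_prime_decomp (fact_gt0 N)) prime_decompE.
  rewrite big_map /= -big_filter.
  apply/eq_leq/perm_big/uniq_perm.
  - exact/filter_uniq/iota_uniq.
  - exact: primes_uniq.
  move=> p; rewrite mem_filter mem_index_iota mem_primes fact_gt0.
  case: (boolP (prime p)) => //= pp; rewrite prime_dvd_fact //.
  by rewrite prime_gt0.
have F : ln (N`!%:R : R) <= N%:R * ln N%:R.
  rewrite mulr_natl -lnXn ?ltr0n // ler_ln ?posrE ?exprn_gt0 ?ltr0n ?fact_gt0 //.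
  rewrite -natrX ler_nat; elim: (N) => // k IH; rewrite factS expnS leq_mul2l /=.
  by case: (k) IH => // j IH; apply: leq_trans IH _; rewrite leq_exp2r.
have N0 : 0 < N%:R :> R by rewrite ltr0n.
rewrite -(ler_pM2l N0); apply: (@le_trans _ _ (2 * (N%:R * ln N%:R))); last by lra.
apply: (le_trans _ (ler_wpM2l (ler0n R 2) (le_trans L F))).
rewrite !mulr_sumr; rewrite big_nat_cond [X in _ <= X]big_nat_cond.
apply: ler_sum => p /andP[/andP[p1 pN] pp].
have p0 : 0 < p%:R :> R by rewrite ltr0n.
rewrite mulrCA [X in _ <= X]mulrCA [X in _ <= X]mulrA [X in _ <= X]mulrC.
rewrite ler_wpM2l ?ln_ge0 ?ler1n // ler_pdivrMr //.
rewrite -!natrM ler_nat.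
have := divn_eq N p; have := ltn_pmod N p1.
have : (0 < N %/ p)%N by rewrite divn_gt0.
nia.
Qed.

(** * The functions f_q and gamma_q for squarefree q *)

(* The common value of [f_q (p ^ k)], [k >= 1], when [p] divides [q] exactly
   once. *)
Definition f_prime (R : realType) (h : nat -> R) (p : nat) : R :=
  h p * (1 - 1 / p%:R) * (1 - h p / p%:R)^-1.

Definition gamma_prime (R : realType) (h : nat -> R) (p : nat) : R :=
  ((1 - h p / p%:R) / (1 - 1 / p%:R))^-1.

Lemma prod_primes_gt0 (s : seq nat) :
  all prime s -> (0 < \prod_(p <- s) p)%N.
Proof.
by move=> /allP aps; rewrite big_seq prodn_cond_gt0 // => p /aps/prime_gt0.
Qed.

Lemma dvdn_prod_primes (p : nat) (s : seq nat) :
  prime p -> all prime s -> (p %| \prod_(t <- s) t)%N = (p \in s).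
Proof.
move=> pp aps; apply/idP/idP => [|ps]; last by rewrite (big_rem p) //= dvdn_mulr.
apply: contraTT => ps; have := coprime_prod_primes pp aps ps.
by rewrite prime_coprime.
Qed.

Lemma logn_prod_primes (p : nat) (s : seq nat) :
  uniq s -> all prime s -> p \in s -> logn p (\prod_(t <- s) t) = 1%N.
Proof.
move=> us aps ps; have pp := allP aps p ps.
rewrite (big_rem p) //= lognM ?(prime_gt0 pp) //; last first.
  by rewrite prod_primes_gt0 //; apply/allP => t /mem_rem /(allP aps).
rewrite logn_prime // eqxx lognE dvdn_prod_primes // ?mem_rem_uniqF //.
  by rewrite !andbF.
by apply/allP => t /mem_rem /(allP aps).
Qed.

Lemma primes_prod_primes (s : seq nat) :
  uniq s -> all prime s -> perm_eq (primes (\prod_(p <- s) p)) s.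
Proof.
move=> us aps; apply: uniq_perm => //; first exact: primes_uniq.
move=> p; rewrite mem_primes prod_primes_gt0 //=.
case: (boolP (prime p)) => pp /=; first by rewrite dvdn_prod_primes.
by apply/esym/negbTE; apply: contra pp => /(allP aps).
Qed.

Lemma totient_prod_primes (s : seq nat) :
  uniq s -> all prime s ->
  totient (\prod_(p <- s) p) = (\prod_(p <- s) p.-1)%N.
Proof.
elim: s => [|p s IH] /=; first by rewrite !big_nil.
move=> /andP[ps us] /andP[pp aps]; rewrite !big_cons.
by rewrite totient_coprime ?coprime_prod_primes // IH // totient_prime.
Qed.

Lemma gamma_prod_primes (R : realType) (h : nat -> R) (s : seq nat) :
  uniq s -> all prime s ->
  gamma_ h (\prod_(p <- s) p) = \prod_(p <- s) gamma_prime h p.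
Proof. by move=> us aps; apply: perm_big; exact: primes_prod_primes. Qed.

(** For squarefree [q], every prime of [gcdn n q] has exponent 1 in [q], so only the second branch
    of [f_local] occurs, and the value depends only on which primes of [s] divide [n]. *)
Lemma f_int_prod_primes (R : realType) (h : nat -> R) (s : seq nat) (n : nat) :
  uniq s -> all prime s ->
  f_int h (\prod_(p <- s) p) n%:Z =
  \prod_(p <- s) (if (p %| n)%N then f_prime h p else 1).
Proof.
move=> us aps; rewrite /f_int absz_nat /f_; set q := (\prod_(p <- s) p)%N.
have q0 : (0 < q)%N by exact: prod_primes_gt0.
have g0 : (0 < gcdn n q)%N by rewrite gcdn_gt0 q0 orbT.
rewrite (perm_big [seq p <- s | (p %| n)%N]) /=; last first.
  apply: uniq_perm; rewrite ?primes_uniq ?filter_uniq // => p.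
  rewrite mem_filter mem_primes g0 dvdn_gcd /=.
  case: (boolP (prime p)) => pp /=; first by rewrite dvdn_prod_primes.
  apply/esym/negbTE; apply: contra pp => /andP[_]; exact: (allP aps).
rewrite big_filter -big_mkcondr /= [RHS]big_mkcond /=.
rewrite [LHS]big_mkcond big_seq [RHS]big_seq; apply: eq_bigr => p ps.
have pp := allP aps p ps; have pq : (p %| q)%N by rewrite dvdn_prod_primes.
rewrite /f_local pq andbT; case: ifP => // pn.
rewrite logn_prod_primes // ltnNge logn_gt0 mem_primes pp g0.
by rewrite dvdn_gcd pn pq /= expn1.
Qed.

Lemma f_int_coprime (R : realType) (h : nat -> R) (q n : nat) :
  coprime n q -> f_int h q n%:Z = 1.
Proof. by rewrite /f_int absz_nat /f_ => /eqP ->; rewrite big_nil. Qed.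

(** In the form [(p - 1) / (p - h p)] the bound is elementary. It shows that each prime lowers the
    density by at least its weight [(1 - h p) / p], the quantity in which blocks are measured. *)
Lemma gamma_prime_bounds (R : realType) (h : nat -> R) (p : nat) :
  prime p -> 0 <= h p <= 1 ->
  0 < gamma_prime h p <= 1 - (1 - h p) / p%:R.
Proof.
move=> pp /andP[h0 h1]; have p2 : 2 <= p%:R :> R by rewrite ler_nat prime_gt1.
have p0 : 0 < p%:R :> R by lra.
have ph0 : 0 < p%:R - h p by lra.
have -> : gamma_prime h p = (p%:R - 1) / (p%:R - h p).
  by rewrite /gamma_prime; field; rewrite !gt_eqF //; lra.
apply/andP; split; first by apply: divr_gt0 => //; lra.
rewrite ler_pdivrMr //.
have -> : (1 - (1 - h p) / p%:R) * (p%:R - h p) =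
  (p%:R - 1) + (1 - h p) * h p / p%:R by field; rewrite gt_eqF.
by rewrite lerDl !mulr_ge0 ?invr_ge0 //; lra.
Qed.

(** * The Maier matrix *)

(** The difference covers the interval [(N, N + M l]], so [s = 0] is excluded. Raising [M] by one
    adds [l] consecutive integers, of which only the last is congruent to [N]. *)
Lemma summatory_apB (R : realType) (a : nat -> R) (l M N : nat) : (0 < l)%N ->
  summatory_ap a (N + M * l)%N%:R l N%:Z - summatory_ap a N%:R l N%:Z =
  \sum_(1 <= s < M.+1) a (N + s * l)%N.
Proof.
move=> l0; rewrite /summatory_ap !natrK.
elim: M => [|M IH]; first by rewrite mul0n addn0 subrr big_geq.
rewrite big_nat_recr //= -IH mulSn (addnC l) addnA.
set K := (N + M * l)%N.
rewrite (big_cat_nat _ (n := K.+1)) //=; last by lia.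
rewrite addrAC; congr (_ + _ + _).
rewrite big_mkcond big_nat_recr /=; last by lia.
rewrite !modz_nat eqz_nat.
have -> : (K + l == N %[mod l])%N by rewrite modnDr /K addnC modnMDl.
rewrite big_nat_cond big1 ?add0r; first by [].
move=> n /andP[/andP[n1 n2] _]; rewrite !modz_nat eqz_nat ifF //.
apply/negbTE/negP; have -> : n = (M * l + (N + (n - K)))%N by rewrite /K; lia.
rewrite modnMDl -{2}[N]addn0 eqn_modDl mod0n modn_small; first by lia.
by lia.
Qed.

Definition ap_error (R : realType) (a h : nat -> R) (x y : R) (l : nat)
    (b : int) : R :=
  summatory_ap a y l b -
  f_int h l b / (l%:R * gamma_ h l) * y * (summatory a x / x).

(** The main term of [ap_error] is linear in [y]: subtracting its values at [N + K l] and [N] turns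
    the length [K l] over the modulus [l] into the factor [K], at the cost of two errors [d]. *)
Lemma progression_sum_error (R : realType) (a h : nat -> R) (x d : R)
    (l K N : nat) :
  (0 < l)%N -> x / 4 < N%:R -> (N + K * l)%N%:R < x ->
  (forall (y : R) (b : int), x / 4 < y < x -> `|ap_error a h x y l b| <= d) ->
  `|\sum_(1 <= i < K.+1) a (N + i * l)%N -
    f_int h l N%:Z / gamma_ h l * K%:R * (summatory a x / x)| <= 2 * d.
Proof.
move=> l0 N1 N2 D.
have NK : N%:R <= (N + K * l)%N%:R :> R by rewrite ler_nat leq_addr.
have D1 : `|ap_error a h x N%:R l N%:Z| <= d.
  by apply: D; rewrite N1 (le_lt_trans NK N2).
have D2 : `|ap_error a h x (N + K * l)%N%:R l N%:Z| <= d.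
  by apply: D; rewrite N2 (lt_le_trans N1 NK).
have lR : (l%:R : R) != 0 by rewrite pnatr_eq0 -lt0n.
rewrite mulr_natl mulr2n; apply: le_trans (lerD D2 D1).
apply: le_trans (ler_normB _ _); rewrite le_eqVlt; apply/orP; left; apply/eqP.
rewrite -summatory_apB // /ap_error; congr `|_|.
rewrite natrD natrM invfM.
set g := (gamma_ h l)^-1; set t := summatory a x / x.
set A1 := summatory_ap _ _ _ _; set A2 := summatory_ap _ _ _ _.
by field.
Qed.

Lemma gamma_prime_le1 (R : realType) (h : nat -> R) (p : nat) :
  prime p -> 0 <= h p <= 1 -> 0 < gamma_prime h p <= 1.
Proof.
move=> pp hp; have /andP[-> g1] := gamma_prime_bounds pp hp.
apply: le_trans g1 _; rewrite gerBl divr_ge0 //.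
by case/andP: hp => _; rewrite subr_ge0.
Qed.

Lemma prod_gamma_prime_le1 (R : realType) (h : nat -> R) (T : seq nat) :
  all prime T -> (forall n, (0 < n)%N -> 0 <= h n <= 1) ->
  0 < \prod_(p <- T) gamma_prime h p <= 1.
Proof.
move=> aT h01; elim: T aT => [|p T IH] /=; first by rewrite big_nil lexx ltr01.
move=> /andP[pp /IH /andP[G0 G1]]; rewrite big_cons.
have /andP[g0 g1] := gamma_prime_le1 pp (h01 p (prime_gt0 pp)).
by rewrite mulr_gt0 //= mulr_ile1 // ltW.
Qed.

(** The ratio of [n] to its totient, for [n] the product of distinct primes [T]. *)
Definition totient_ratio (R : realType) (T : seq nat) : R :=
  \prod_(p <- T) (p%:R / (p%:R - 1)).

Lemma totient_ratioE (R : realType) (T : seq nat) :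
  uniq T -> all prime T ->
  totient_ratio R T * (totient (\prod_(p <- T) p))%:R = (\prod_(p <- T) p)%N%:R.
Proof.
move=> uT aT; rewrite totient_prod_primes // /totient_ratio.
elim: T {uT} aT => [|p T IH] /=; first by rewrite !big_nil mulr1.
move=> /andP[pp aT]; rewrite !big_cons !natrM -IH //.
have p1 := prime_gt1 pp.
have -> : p.-1%:R = p%:R - 1 :> R by rewrite -subn1 natrB // prime_gt0.
have : (p%:R : R) - 1 != 0 by rewrite subr_eq0 -[1]/(1%:R) eqr_nat; lia.
by move=> ?; field.
Qed.

Lemma totient_ratio_ge1 (R : realType) (T : seq nat) :
  all prime T -> 1 <= totient_ratio R T.
Proof.
rewrite /totient_ratio; elim: T => [|p T IH] /=; first by rewrite big_nil.
move=> /andP[pp /IH H]; rewrite big_cons.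
have p2 : 2 <= p%:R :> R by rewrite ler_nat prime_gt1.
by apply: mulr_ege1 => //; rewrite ler_pdivlMr; lra.
Qed.

(* The matrix with entries [q (1 + r rho) + s r ^ m]: its columns are
   progressions modulo [q r] and its rows are progressions modulo [r ^ m] to
   residues prime to [r]. *)
Lemma maier_matrix (R : realType) (a h : nat -> R) (x e : R) (T : seq nat)
    (r m M : nat) :
  (forall n, (0 < n)%N -> 0 <= h n <= 1) ->
  uniq (r :: T) -> all prime (r :: T) -> (0 < m)%N ->
  0 < x -> 0 < summatory a x -> 0 <= e ->
  x / 8 <= M%:R * (r ^ m)%N%:R <= x / 4 ->
  16 * (\prod_(p <- r :: T) p)%N%:R <= x ->
  (forall l, l = (r ^ m)%N \/ l = (\prod_(p <- r :: T) p)%N ->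
     forall (y : R) (b : int), x / 4 < y < x ->
     `|ap_error a h x y l b| <= e * (summatory a x / (totient l)%:R)) ->
  `|\sum_(1 <= s < M.+1)
      \prod_(p <- T) (if (p %| s)%N then f_prime h p else 1) -
    M%:R * \prod_(p <- T) gamma_prime h p| <= 64 * totient_ratio R T * e * M%:R.
Proof.
move=> h01 urT arT m0 x0 A0 e0 /andP[Ml1 Ml2] Qx D.
set l := (r ^ m)%N in Ml1 Ml2 D.
set Q := (\prod_(p <- r :: T) p)%N in Qx D.
have /andP[rT uT] : (r \notin T) && uniq T by [].
have /andP[rp aT] : prime r && all prime T by [].
have l0 : (0 < l)%N by rewrite expn_gt0 prime_gt0.
have Q0 : (0 < Q)%N by exact: prod_primes_gt0.
have QE : Q = (r * \prod_(p <- T) p)%N by rewrite /Q big_cons.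
set q := (\prod_(p <- T) p)%N in QE.
have Q0R : 0 < Q%:R :> R by rewrite ltr0n.
have l0R : 0 < l%:R :> R by rewrite ltr0n.
set K := Num.truncn (x / 4 / Q%:R).
have [K1 K2] : K%:R * Q%:R <= x / 4 /\ x / 4 < K%:R * Q%:R + Q%:R.
  have : 0 <= x / 4 / Q%:R by rewrite divr_ge0 //; lra.
  move=> /truncn_itv/andP[]; rewrite -/K ler_pdivlMr // => -> ub; split => //.
  by move: ub; rewrite ltr_pdivrMr // -[K.+1%:R]natr1 mulrDl mul1r.
(* The base point is [q (1 + r (K + 1))]: divisible by every prime of [T], prime to [r], and already
   beyond [x / 4]. *)
set N0 := (q + K.+1 * Q)%N.
have N0R : N0%:R = q%:R + K%:R * Q%:R + Q%:R :> R.
  by rewrite /N0 natrD natrM -natr1; ring.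
have qQ : q%:R <= Q%:R :> R by rewrite ler_nat QE leq_pmull ?prime_gt0.
have q0 : 0 <= q%:R :> R by rewrite ler0n.
(* Each entry is at most [2 Q + 2 K Q + M l], hence at most [x / 8 + x / 2 + x / 4 < x]. *)
have range i s : (i <= K)%N -> (s <= M)%N ->
    x / 4 < (N0 + i * Q + s * l)%N%:R < x.
  move=> iK sM; rewrite natrD [(N0 + _)%:R]natrD N0R !natrM.
  have i1 : 0 <= i%:R * Q%:R :> R by rewrite mulr_ge0 // ler0n.
  have s1 : 0 <= s%:R * l%:R :> R by rewrite mulr_ge0 // ler0n.
  have i2 : i%:R * Q%:R <= K%:R * Q%:R :> R by rewrite ler_pM2r // ler_nat.
  have s2 : s%:R * l%:R <= M%:R * l%:R :> R by rewrite ler_pM2r // ler_nat.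
  by apply/andP; split; lra.
set F := fun s => \prod_(p <- T) (if (p %| s)%N then f_prime h p else 1).
set G := \prod_(p <- T) gamma_prime h p.
set gr := gamma_prime h r.
set A := summatory a x in A0 D *.
set t := A / x.
have rN0 k : ~~ (r %| N0 + k * Q)%N.
  rewrite /N0 -addnA -mulnDl QE mulnCA dvdn_addl ?dvdn_mulr //.
  by rewrite -prime_coprime // coprime_prod_primes.
have rl : (r %| l)%N by rewrite /l -(prednK m0) expnS dvdn_mulr.
(* A prime of [T] divides [N0] but not [l], so it divides the residue [N0 + s l] exactly when it
   divides [s]; [r] divides [l] but not [N0] and contributes 1. *)
have Dcol s : (1 <= s < M.+1)%N ->
    `|\sum_(1 <= i < K.+1) a (N0 + i * Q + s * l)%N - F s / (gr * G) * K%:R * t|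
    <= 2 * (e * (A / (totient Q)%:R)).
  move=> /andP[s1]; rewrite ltnS => sM.
  have := @progression_sum_error _ a h x (e * (A / (totient Q)%:R)) Q K
    (N0 + s * l) Q0.
  have /andP[r1 _] := range 0%N s (leq0n _) sM.
  have /andP[_ r2] := range K s (leqnn _) sM.
  rewrite mul0n addn0 in r1; rewrite addnAC in r2.
  move=> /(_ r1 r2 (D _ (or_intror erefl))).
  rewrite gamma_prod_primes // big_cons f_int_prod_primes // big_cons ifF.
    rewrite mul1r -/A -/t -/gr -/G.
    rewrite (_ : \prod_(j <- T) _ = F s).
      by under eq_bigr => i _ do rewrite addnAC.
    rewrite /F big_seq [RHS]big_seq; apply: eq_bigr => p pT.
    have pp := allP aT p pT.
    have pN0 : (p %| N0)%N.
      have pq : (p %| q)%N by rewrite dvdn_prod_primes.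
      by rewrite /N0 QE dvdn_add // !dvdn_mull.
    rewrite dvdn_addr // Euclid_dvdM // [(p %| l)%N]Euclid_dvdX // m0 andbT.
    rewrite [(p %| r)%N]dvdn_prime2 // [p == r](_ : _ = false) ?orbF //.
    by apply/negbTE; apply: contra rT => /eqP <-.
  apply/negbTE; rewrite dvdn_addl; last by rewrite dvdn_mull.
  by have := rN0 0%N; rewrite mul0n addn0.
(* The residue [N0 + i Q] is prime to [r], so here [f_l] is 1 and only [gr] remains of the
   density. *)
have Drow i : (1 <= i < K.+1)%N ->
    `|\sum_(1 <= s < M.+1) a (N0 + i * Q + s * l)%N - gr^-1 * M%:R * t|
    <= 2 * (e * (A / (totient l)%:R)).
  move=> /andP[i1]; rewrite ltnS => iK.
  have := @progression_sum_error _ a h x (e * (A / (totient l)%:R)) l M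
    (N0 + i * Q) l0.
  have /andP[r1 _] := range i 0%N iK (leq0n _).
  have /andP[_ r2] := range i M iK (leqnn _).
  rewrite mul0n addn0 in r1.
  move=> /(_ r1 r2 (D _ (or_introl erefl))).
  rewrite f_int_coprime; last first.
    by rewrite coprime_sym coprimeXl // prime_coprime.
  by rewrite /gamma_ primesX // primes_prime // big_seq1 -/(gamma_prime h r) div1r.
have /andP[G0 G1] : 0 < G <= 1 by exact: prod_gamma_prime_le1.
have /andP[g0 g1] : 0 < gr <= 1 by apply: gamma_prime_le1 => //; apply/h01/prime_gt0.
have K0 : 0 < K%:R :> R by rewrite -(pmulr_lgt0 _ Q0R); lra.
have t0 : 0 < t by rewrite divr_gt0.
have Scol : `|\sum_(1 <= s < M.+1) \sum_(1 <= i < K.+1) a (N0 + i * Q + s * l)%N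
     - (\sum_(1 <= s < M.+1) F s) / (gr * G) * K%:R * t| <=
     M%:R * (2 * (e * (A / (totient Q)%:R))).
  rewrite 2!mulr_suml [X in _ - X]mulr_suml -sumrB; apply: le_trans (ler_norm_sum _ _ _) _.
  apply: (@le_trans _ _ (\sum_(1 <= s < M.+1) (2 * (e * (A / (totient Q)%:R))))).
    by rewrite big_nat_cond [X in _ <= X]big_nat_cond ler_sum // => s /andP[/Dcol].
  by rewrite sumr_const_nat subn1 [M%:R * _]mulr_natl.
have Srow : `|\sum_(1 <= i < K.+1) \sum_(1 <= s < M.+1) a (N0 + i * Q + s * l)%N
     - K%:R * (gr^-1 * M%:R * t)| <=
     K%:R * (2 * (e * (A / (totient l)%:R))).
  rewrite [K%:R * (gr^-1 * _ * _)]mulr_natl -{2}[K](subn1 K.+1) -sumr_const_nat.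
  rewrite -sumrB; apply: le_trans (ler_norm_sum _ _ _) _.
  apply: (@le_trans _ _ (\sum_(1 <= s < K.+1) (2 * (e * (A / (totient l)%:R))))).
    by rewrite big_nat_cond [X in _ <= X]big_nat_cond ler_sum // => s /andP[/Drow].
  by rewrite sumr_const_nat subn1 [K%:R * _]mulr_natl.
rewrite exchange_big /= in Srow.
set SF := \sum_(1 <= s < M.+1) F s in Scol *.
(* Rows and columns sum the same matrix. Their main terms share the factor [K t / gr], and the
   discrepancy is [SF / G - M]. *)
have {Scol Srow} : `|K%:R * t / (gr * G) * (SF - M%:R * G)| <=
    M%:R * (2 * (e * (A / (totient Q)%:R))) + K%:R * (2 * (e * (A / (totient l)%:R))).
  apply: le_trans (lerD Scol Srow); rewrite [X in _ <= X]addrC.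
  apply: le_trans (ler_normB _ _); rewrite le_eqVlt; apply/orP; left; apply/eqP.
  congr `|_|; field; by rewrite !gt_eqF.
have kt0 : 0 < K%:R * t / (gr * G) by rewrite !(divr_gt0, mulr_gt0).
rewrite normrM (gtr0_norm kt0) mulrC -ler_pdivlMr // => /le_trans; apply.
set Phi := totient_ratio R T.
have Phi1 : 1 <= Phi by exact: totient_ratio_ge1.
have r2 : 2 <= r%:R :> R by rewrite ler_nat prime_gt1.
have phl0 : 0 < (totient l)%:R :> R by rewrite ltr0n totient_gt0.
have phQ0 : 0 < (totient Q)%:R :> R by rewrite ltr0n totient_gt0.
have ErQ : Phi * (r%:R / (r%:R - 1)) * (totient Q)%:R = Q%:R.
  rewrite -(totient_ratioE R urT) // /totient_ratio big_cons -/Phi.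
  by rewrite [_ * Phi]mulrC.
have rr : r%:R / (r%:R - 1) <= 2 :> R by rewrite ler_pdivrMr; lra.
have EQ : Q%:R <= 2 * Phi * (totient Q)%:R.
  rewrite -ErQ ler_pM2r // mulrC ler_pM2r //; lra.
have El : l%:R <= 2 * (totient l)%:R :> R.
  rewrite -natrM ler_nat totient_pfactor // /l -{1}(prednK m0) expnS mulnA leq_pmul2r.
    by move: (prime_gt1 rp); clear; lia.
  by rewrite expn_gt0 prime_gt0.
(* Since [16 Q <= x], the choice of [K] gives [K Q > x / 4 - Q >= 3 x / 16]. *)
have HQ : x / (K%:R * (totient Q)%:R) <= 16 * Phi.
  rewrite ler_pdivrMr ?mulr_gt0 //.
  have : K%:R * Q%:R <= K%:R * (2 * Phi * (totient Q)%:R) by rewrite ler_pM2l.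
  nra.
have Hl : x / (totient l)%:R <= 16 * M%:R.
  rewrite ler_pdivrMr //.
  have : M%:R * l%:R <= M%:R * (2 * (totient l)%:R) :> R.
    by rewrite ler_wpM2l // ler0n.
  nra.
have -> : (M%:R * (2 * (e * (A / (totient Q)%:R))) +
   K%:R * (2 * (e * (A / (totient l)%:R)))) / (K%:R * t / (gr * G)) =
   2 * e * (gr * G) * (M%:R * (x / (K%:R * (totient Q)%:R)) + x / (totient l)%:R).
  by rewrite /t; field; rewrite !gt_eqF.
have gG : gr * G <= 1 by rewrite mulr_ile1 // ltW.
have M0 : 0 <= M%:R :> R by rewrite ler0n.
have B1 : M%:R * (x / (K%:R * (totient Q)%:R)) + x / (totient l)%:R
    <= 32 * Phi * M%:R.
  have := ler_wpM2l M0 HQ; have := ler_wpM2r M0 Phi1; lra.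
have B0 : 0 <= M%:R * (x / (K%:R * (totient Q)%:R)) + x / (totient l)%:R.
  by rewrite addr_ge0 ?mulr_ge0 ?invr_ge0 //; rewrite ltW // ?mulr_gt0.
apply: (@le_trans _ _ (2 * e * 1 * (32 * Phi * M%:R))); last by lra.
have e2 : 0 <= 2 * e by lra.
apply: ler_pM => //; first by rewrite mulr_ge0 // ltW // mulr_gt0.
by rewrite ler_wpM2l.
Qed.

(** * Alternating sums over unions of blocks of primes *)

(** Induction on the blocks: expanding the factor [1 - prod] of [B] gives the statement for [T]
    minus that for [T ++ B]. Each block thus doubles the number of error terms [E]. *)
Lemma sum_alternating_blocks (R : realType) (phi : nat -> nat -> R)
    (gam : nat -> R) (M : nat) (E : R) (ps : seq nat) :
  (forall T, uniq T -> {subset T <= ps} ->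
    `|\sum_(1 <= s < M.+1) \prod_(p <- T) phi p s -
      M%:R * \prod_(p <- T) gam p| <= E) ->
  forall (Bs : seq (seq nat)) (T : seq nat),
  uniq (T ++ flatten Bs) -> {subset T ++ flatten Bs <= ps} ->
  `|\sum_(1 <= s < M.+1) (\prod_(p <- T) phi p s *
       \prod_(B <- Bs) (1 - \prod_(p <- B) phi p s)) -
    M%:R * (\prod_(p <- T) gam p * \prod_(B <- Bs) (1 - \prod_(p <- B) gam p))|
  <= 2 ^+ size Bs * E.
Proof.
move=> H; elim => [|B Bs IH] T /=.
  rewrite cats0 => uT sT; rewrite expr0 mul1r.
  rewrite (_ : \sum_(_ <= _ < _) _ = \sum_(1 <= s < M.+1) \prod_(p <- T) phi p s);
    last by apply: eq_bigr => s _; rewrite big_nil mulr1.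
  by rewrite big_nil mulr1; exact: H.
move=> uT sT.
have H1 := IH (T ++ B); have H2 := IH T.
rewrite -catA in H1; have {}H1 := H1 uT sT.
have u2 : uniq (T ++ flatten Bs).
  apply: subseq_uniq uT; rewrite cat_subseq // ?subseq_refl //.
  exact: suffix_subseq.
have s2 : {subset T ++ flatten Bs <= ps}.
  move=> p; rewrite mem_cat => pT; apply: sT; rewrite !mem_cat.
  by case/orP: pT => ->; rewrite ?orbT.
have {}H2 := H2 u2 s2.
rewrite exprS -mulrA mulrDl mul1r.
apply: le_trans (lerD H2 H1); apply: le_trans (ler_normB _ _).
rewrite le_eqVlt; apply/orP; left; apply/eqP; congr `|_|.
rewrite big_cons !big_cat /= opprD addrACA -sumrB; congr (_ + _).
  apply: eq_bigr => s _; rewrite big_cons big_cat /=; ring.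
ring.
Qed.

(** A prefix is extended until its weight reaches [c]; the last element overshoots by at most [d].
    The alternative [B = [::]] covers an empty [s], where nothing forces [d] to be non-negative. *)
Lemma split_threshold (R : realType) (w : nat -> R) (d : R) (s : seq nat) :
  (forall p, p \in s -> 0 <= w p <= d) ->
  forall c, 0 <= c -> c <= \sum_(p <- s) w p ->
  exists B t, [/\ s = B ++ t, c <= \sum_(p <- B) w p &
                  \sum_(p <- B) w p <= c + d \/ B = [::]].
Proof.
elim: s => [|p s IH] H c c0.
  by rewrite big_nil => c1; exists [::], [::]; split; [|rewrite big_nil|right].
have /andP[wp0 wpd] := H p (mem_head _ _).
case: (leP c (w p)) => cw; rewrite big_cons => cs.
  exists [:: p], s; split => //; rewrite big_seq1 //; left; lra.
have [|||B [t [-> B1 B2]]] := IH _ (c - w p).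
- by move=> t ts; apply: H; rewrite inE ts orbT.
- lra.
- lra.
exists (p :: B), t; split => //; rewrite big_cons; first lra.
left; case: B2 => [B2|->]; [lra|rewrite big_nil; lra].
Qed.

(** Each block has threshold [d] and overshoot at most [d], so it consumes at most [2 d] of the
    total weight. *)
Lemma greedy_blocks (R : realType) (w : nat -> R) (d : R) (k : nat)
    (s : seq nat) : 0 <= d ->
  (forall p, p \in s -> 0 <= w p <= d) -> 2 * k%:R * d <= \sum_(p <- s) w p ->
  exists (Bs : seq (seq nat)) (t : seq nat),
    [/\ size Bs = k, s = flatten Bs ++ t &
        forall B, B \in Bs -> d <= \sum_(p <- B) w p].
Proof.
move=> d0; elim: k s => [|k IH] s H Hs; first by exists [::], s.
have [|B [t [Es B1 B2]]] := split_threshold H d0.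
  by apply: le_trans Hs; rewrite -natr1; have := ler0n R k; nra.
have B2' : \sum_(p <- B) w p <= 2 * d.
  by case: B2 => [|->]; rewrite ?big_nil; lra.
have [||Bs [t' [sB Et HB]]] := IH t.
- by move=> p pt; apply: H; rewrite Es mem_cat pt orbT.
- move: Hs; rewrite Es big_cat /= -natr1; lra.
exists (B :: Bs), t'; split => /=; first by rewrite sB.
  by rewrite Es Et catA.
by move=> C; rewrite inE => /orP[/eqP ->|/HB].
Qed.

Lemma has_blocks_size_filter (Q : pred nat) (Bs : seq (seq nat)) :
  all (has Q) Bs -> (size Bs <= size [seq p <- flatten Bs | Q p])%N.
Proof.
elim: Bs => //= B Bs IH /andP[hB hBs]; rewrite filter_cat size_cat.
by rewrite -add1n leq_add ?IH // size_filter -has_count.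
Qed.

Lemma large_primes_prod (R : realType) (P : R) (s : seq nat) : 0 <= P ->
  (forall p, p \in s -> P <= p%:R) -> P ^+ size s <= (\prod_(p <- s) p)%N%:R.
Proof.
move=> P0; elim: s => [|p s IH] H; first by rewrite big_nil expr0.
rewrite big_cons natrM exprS ler_pM ?exprn_ge0 ?H ?mem_head //.
by apply: IH => t ts; apply: H; rewrite inE ts orbT.
Qed.

(* No [s <= M] has a prime factor in each of the [k] blocks, since their
   product would exceed [P ^+ k > M]; so the alternating sum over unions of
   blocks kills the values [phi] and leaves only the densities [gam]. *)
Lemma prod_blocks_le (R : realType) (phi : nat -> nat -> R)
    (gam : nat -> R) (M : nat) (E P : R) (ps : seq nat) (Bs : seq (seq nat)) :
  (forall p s, ~~ (p %| s)%N -> phi p s = 1) ->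
  (forall T, uniq T -> {subset T <= ps} ->
    `|\sum_(1 <= s < M.+1) \prod_(p <- T) phi p s -
      M%:R * \prod_(p <- T) gam p| <= E) ->
  uniq (flatten Bs) -> {subset flatten Bs <= ps} -> all prime ps ->
  1 <= P -> (forall p, p \in ps -> P <= p%:R) -> M%:R < P ^+ size Bs ->
  M%:R * \prod_(B <- Bs) (1 - \prod_(p <- B) gam p) <= 2 ^+ size Bs * E.
Proof.
move=> phi1 H uB sB aps P1 HP MP.
have := sum_alternating_blocks H (T := [::]) uB sB.
rewrite big1_seq => [|s /andP[_]]; last first.
  rewrite mem_index_iota big_nil mul1r => /andP[s1 sM].
  case: (boolP (all (has (fun p => p %| s)%N) Bs)) => [hB|].
    exfalso; have := has_blocks_size_filter hB.
    set D := [seq p <- _ | _] => kD.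
    have DP p : p \in D -> P <= p%:R.
      by rewrite mem_filter => /andP[_ /sB]; exact: HP.
    have : (\prod_(p <- D) p %| s)%N.
      apply: prod_primes_dvdn; first exact: filter_uniq.
        by apply/allP => p; rewrite mem_filter => /andP[_ /sB/(allP aps)].
      by move=> p; rewrite mem_filter => /andP[].
    move=> /(dvdn_leq s1); rewrite -(ler_nat R) => Ds.
    have P0 : 0 <= P by lra.
    have := large_primes_prod P0 DP.
    have : P ^+ size Bs <= P ^+ size D by rewrite ler_weXn2l.
    have : s%:R <= M%:R :> R by rewrite ler_nat.
    lra.
  (* On a block without prime factor of [s] every [phi p s] is 1, so its factor is [1 - 1]. *)
  move=> /allPn[B BB hB]; rewrite (big_rem B) //= big1_seq ?subrr ?mul0r //.
  move=> p /andP[_ pB]; apply: phi1; apply: contra hB => pdvd.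
  by apply/hasP; exists p.
rewrite big_nil mul1r sub0r normrN; exact: le_trans (ler_norm _).
Qed.

(** * Exponential bounds for products over primes *)

Lemma ler_sum_subset (R : realType) (F : nat -> R) (s t : seq nat) :
  uniq s -> {subset s <= t} -> (forall p, p \in t -> 0 <= F p) ->
  \sum_(p <- s) F p <= \sum_(p <- t) F p.
Proof.
elim: s t => [|x s IH] t /=.
  by move=> _ _ H; rewrite big_nil big_seq sumr_ge0.
move=> /andP[xs us] st H; have xt : x \in t by apply: st; rewrite mem_head.
rewrite big_cons (big_rem x xt) /= lerD2l; apply: IH => //.
  move=> y ys; have : y \in t by apply: st; rewrite inE ys orbT.
  rewrite (perm_mem (perm_to_rem xt)) inE => /orP[/eqP yx|//].
  by move: xs; rewrite -yx ys.
by move=> p /mem_rem; exact: H.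
Qed.

Lemma ler_prod_expR_sum (R : realType) (F G : nat -> R) (s : seq nat) :
  (forall p, p \in s -> 0 <= F p <= expR (G p)) ->
  \prod_(p <- s) F p <= expR (\sum_(p <- s) G p).
Proof.
elim: s => [|p s IH] H; first by rewrite !big_nil expR0.
rewrite !big_cons expRD; have /andP[F0 F1] := H p (mem_head _ _).
apply: ler_pM => //.
  rewrite big_seq prodr_ge0 // => t ts.
  by have /andP[] := H t (mem_behead (s := p :: s) ts).
by apply: IH => t ts; apply: H; rewrite inE ts orbT.
Qed.

(** For [p >= 2] one has [p / (p - 1) <= 1 + 2 / p <= expR (2 / p)]. *)
Lemma totient_ratio_le (R : realType) (T : seq nat) :
  all prime T -> totient_ratio R T <= expR (\sum_(p <- T) (2 / p%:R)).
Proof.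
move=> aT; apply: ler_prod_expR_sum => p /(allP aT) pp.
have p2 : 2 <= p%:R :> R by rewrite ler_nat prime_gt1.
apply/andP; split; first by rewrite divr_ge0; lra.
apply: le_trans (expR_ge1Dx _).
rewrite ler_pdivrMr; last lra.
rewrite -subr_ge0 (_ : _ - _ = (p%:R - 2) / p%:R); last by field; rewrite gt_eqF; lra.
by rewrite divr_ge0; lra.
Qed.

(** The product is at most [expR (- d) <= 1 / (1 + d)], which is at most [1 - d / 2] because
    [d <= 1]. *)
Lemma one_sub_prod_gamma_ge (R : realType) (h : nat -> R) (B : seq nat) (d : R) :
  all prime B -> (forall n, (0 < n)%N -> 0 <= h n <= 1) ->
  0 <= d <= 1 -> d <= \sum_(p <- B) (1 - h p) / p%:R ->
  d / 2 <= 1 - \prod_(p <- B) gamma_prime h p.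
Proof.
move=> aB h01 /andP[d0 d1] dB.
have H : \prod_(p <- B) gamma_prime h p <= expR (\sum_(p <- B) - ((1 - h p) / p%:R)).
  apply: ler_prod_expR_sum => p /(allP aB) pp.
  have /andP[g0 g1] := gamma_prime_bounds pp (h01 p (prime_gt0 pp)).
  by rewrite ltW //= (le_trans g1) // expR_ge1Dx.
have : expR (\sum_(p <- B) - ((1 - h p) / p%:R)) <= expR (- d).
  by rewrite ler_expR sumrN lerN2.
have : expR (- d) <= 1 - d / 2.
  rewrite expRN -[X in _ <= X]invrK lef_pV2 ?posrE ?expR_gt0 ?invr_gt0; [|lra|lra].
  apply: le_trans (expR_ge1Dx d); rewrite -[X in X <= _]mul1r ler_pdivrMr; [nra|lra].
lra.
Qed.

(** The inequality forced by good distribution with relative error [e]: the left side bounds the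
    product of block densities from below, and the right side is the error of the matrix argument
    summed over all [2 ^ k] unions of blocks. *)
Lemma oscillation_bound (R : realType) (a h : nat -> R) (x e P d : R)
    (ps : seq nat) (r m M k : nat) :
  (forall n, (0 < n)%N -> 0 <= h n <= 1) ->
  uniq (r :: ps) -> all prime (r :: ps) -> (0 < m)%N ->
  0 < x -> 0 < summatory a x -> 0 <= e ->
  x / 8 <= M%:R * (r ^ m)%N%:R <= x / 4 ->
  16 * (\prod_(p <- r :: ps) p)%N%:R <= x ->
  1 <= P -> (forall p, p \in ps -> P <= p%:R) -> M%:R < P ^+ k ->
  P^-1 <= d <= 1 -> 2 * k%:R * d <= \sum_(p <- ps) (1 - h p) / p%:R ->
  (forall l, l = (r ^ m)%N \/
     (exists T, [/\ uniq T, {subset T <= ps} & l = (\prod_(p <- r :: T) p)%N]) ->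
     forall (y : R) (b : int), x / 4 < y < x ->
     `|ap_error a h x y l b| <= e * (summatory a x / (totient l)%:R)) ->
  (d / 2) ^+ k <= 2 ^+ k * (64 * expR (\sum_(p <- ps) (2 / p%:R)) * e).
Proof.
move=> h01 ur ar m0 x0 A0 e0 Ml Qx P1 HP MP /andP[Pd d1] Hw D.
have /andP[rps ups] : (r \notin ps) && uniq ps by [].
have /andP[rp aps] : prime r && all prime ps by [].
have d0 : 0 <= d by apply: le_trans Pd; rewrite invr_ge0; lra.
have M0 : 0 < M%:R :> R.
  have l0 : 0 < (r ^ m)%N%:R :> R by rewrite ltr0n expn_gt0 prime_gt0.
  by rewrite -(pmulr_lgt0 _ l0); case/andP: Ml => Ml _; apply: lt_le_trans Ml; lra.
have [Bs [t [sB Eps HB]]] : exists (Bs : seq (seq nat)) (t : seq nat),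
    [/\ size Bs = k, ps = flatten Bs ++ t &
        forall B, B \in Bs -> d <= \sum_(p <- B) (1 - h p) / p%:R].
  apply: greedy_blocks => // p pps.
  have pp := allP aps p pps; have /andP[h0 h1] := h01 p (prime_gt0 pp).
  have p0 : 0 < p%:R :> R by rewrite ltr0n prime_gt0.
  apply/andP; split; first by rewrite divr_ge0; lra.
  (* A single prime weighs at most [1 / p <= 1 / P <= d], as the greedy choice requires. *)
  apply: le_trans Pd; rewrite ler_pdivrMr //.
  have Pp := HP p pps; have P0 : 0 < P by lra.
  apply: (@le_trans _ _ 1); first lra.
  by rewrite mulrC ler_pdivlMr // mul1r.
have sub : {subset flatten Bs <= ps} by move=> p pB; rewrite Eps mem_cat pB.
have uB : uniq (flatten Bs) by move: ups; rewrite Eps cat_uniq => /andP[].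
have := @prod_blocks_le R (fun p s => if (p %| s)%N then f_prime h p else 1)
  (gamma_prime h) M (64 * expR (\sum_(p <- ps) (2 / p%:R)) * e * M%:R) P ps Bs.
rewrite sB => /(_ _ _ uB sub aps P1 HP MP) H.
have {}H : M%:R * \prod_(B <- Bs) (1 - \prod_(p <- B) gamma_prime h p) <=
    2 ^+ k * (64 * expR (\sum_(p <- ps) (2 / p%:R)) * e * M%:R).
  apply: H => [p s /negbTE -> //|T uT sT].
  have aT : all prime T by apply/allP => p /sT /(allP aps).
  have rT : r \notin T by apply: contra rps => /sT.
  apply: le_trans (maier_matrix (r := r) (m := m) (e := e) h01 _ _ m0 x0 A0 e0 Ml _ _) _.
  - by rewrite /= rT.
  - by rewrite /= rp.
  - apply: le_trans Qx; rewrite ler_pM2l // ler_nat !big_cons.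
    rewrite leq_pmul2l ?prime_gt0 //; apply: dvdn_leq; first exact: prod_primes_gt0.
    apply: prod_primes_dvdn => // p pT.
    by rewrite dvdn_prod_primes ?sT //; exact: (allP aT).
  - move=> l Hl; apply: D; case: Hl => Hl; [by left|right; exists T; split => //].
  rewrite ler_pM2r // ler_wpM2r // ler_pM2l //.
  apply: le_trans (totient_ratio_le _ aT) _; rewrite ler_expR.
  by apply: ler_sum_subset => // p _; rewrite divr_ge0.
(* After cancelling [M], it remains to bound each block factor below by [d / 2]. *)
rewrite mulrA [X in _ <= X]mulrC ler_pM2l // in H; apply: le_trans H.
rewrite -sB; elim: (Bs) HB {Eps sub uB sB} (sub) => [|B Cs IH] HB sub.
  by rewrite big_nil expr0.
rewrite big_cons exprS ler_pM ?exprn_ge0 //; try lra.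
  apply: one_sub_prod_gamma_ge => //; last by rewrite HB ?mem_head.
    by apply/allP => p pB; apply: (allP aps); apply: sub; rewrite mem_cat pB.
  by rewrite d0.
apply: IH => [C CC|p pC]; first by apply: HB; rewrite inE CC orbT.
by apply: sub; rewrite /= mem_cat pC orbT.
Qed.

(** * Choice of the parameters *)

Lemma four_le_expR2 (R : realType) : 4 <= expR 2 :> R.
Proof.
have -> : 2 = 1 + 1 :> R by [].
by rewrite expRD; have := expR_ge1Dx (1 : R); nra.
Qed.

Definition primes_between (R : realType) (P Y : R) : seq nat :=
  [seq p <- index_iota 1 (Num.truncn Y).+1 | prime p && (P < p%:R)].

Lemma mem_primes_between (R : realType) (P Y : R) (p : nat) : 0 <= Y ->
  (p \in primes_between P Y) = [&& prime p, P < p%:R & p%:R <= Y].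
Proof.
move=> Y0; rewrite mem_filter mem_index_iota ltnS truncn_ge_nat // -andbA.
by case: (boolP (prime p)) => //= /prime_gt0 ->.
Qed.

Lemma uniq_primes_between (R : realType) (P Y : R) : uniq (primes_between P Y).
Proof. exact/filter_uniq/iota_uniq. Qed.

Lemma sum_ln_primes_div_le_real (R : realType) (Y : R) (s : seq nat) : 1 <= Y ->
  uniq s -> (forall p, p \in s -> prime p && (p%:R <= Y)) ->
  \sum_(p <- s) ln (p%:R : R) / p%:R <= 2 * ln Y.
Proof.
move=> Y1 us H; have Y0 : 0 <= Y by lra.
have n0 : (0 < Num.truncn Y)%N by rewrite truncn_gt0.
apply: (@le_trans _ _ (2 * ln (Num.truncn Y)%:R)); last first.
  rewrite ler_pM2l // ler_ln ?posrE ?ltr0n //; last lra.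
  by have /andP[] := truncn_itv Y0.
apply: le_trans (sum_ln_primes_div_le R _); rewrite -[X in _ <= X]big_filter.
apply: ler_sum_subset => // p.
  move=> /H/andP[pp pY]; rewrite mem_filter pp mem_index_iota prime_gt0 //=.
  by rewrite ltnS truncn_ge_nat.
rewrite mem_filter => /andP[/prime_gt0 p0 _].
by rewrite divr_ge0 // ln_ge0 // ler1n.
Qed.

(** Primes up to [P] cost at most [2 ln P]; those of [(P, Z / 4]] satisfy [ln p <= ln Z]; those
    above [Z / 4] have [1 / p < 4 / Z] and cost at most [4 ln 4 <= 8] by Chebyshev's bound. Stopping
    at [Z / 4] keeps the product of the primes below [expR (Z / 2)]. *)
Lemma sum_ln_weight_le (R : realType) (h : nat -> R) (P Z : R) :
  1 <= P -> 1 <= Z -> (forall n, (0 < n)%N -> 0 <= h n <= 1) ->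
  \sum_(1 <= p < (Num.truncn Z).+1 | prime p) (1 - h p) / p%:R * ln (p%:R : R)
  <= 2 * ln P + ln Z * (\sum_(p <- primes_between P (Z / 4)) (1 - h p) / p%:R) + 8.
Proof.
move=> P1 Z1 h01; have Z0 : 0 < Z by lra.
set s := index_iota 1 (Num.truncn Z).+1.
have ms p : p \in s -> (0 < p)%N && (p%:R <= Z).
  by rewrite mem_index_iota ltnS truncn_ge_nat //; exact: ltW.
have us : uniq s by exact: iota_uniq.
have small : \sum_(p <- s | prime p && (p%:R <= P)) ln (p%:R : R) / p%:R <= 2 * ln P.
  rewrite -big_filter; apply: sum_ln_primes_div_le_real; rewrite ?filter_uniq //.
  by move=> p; rewrite mem_filter => /andP[].
have mid : \sum_(p <- s | prime p && ((P < p%:R) && (p%:R <= Z / 4)))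
      ln Z * ((1 - h p) / p%:R) <=
    ln Z * \sum_(p <- primes_between P (Z / 4)) (1 - h p) / p%:R.
  rewrite -mulr_sumr; apply: ler_wpM2l; first exact: ln_ge0.
  rewrite -big_filter; apply: ler_sum_subset; rewrite ?filter_uniq // => p.
    rewrite mem_filter mem_primes_between; last by apply: divr_ge0; lra.
    by move=> /andP[].
  rewrite mem_filter => /andP[/andP[/prime_gt0 p0 _] _].
  by rewrite divr_ge0 // subr_ge0; have /andP[] := h01 p p0.
have big : \sum_(p <- s | prime p) 4 / Z * ln (p%:R : R) <= 8.
  rewrite -mulr_sumr mulrAC ler_pdivrMr //.
  have ln4 : ln 4 <= 2 :> R.
    rewrite -[X in _ <= X]expRK ler_ln ?posrE ?expR_gt0 //.
    exact: four_le_expR2.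
  have ln40 : 0 <= ln 4 :> R by apply: ln_ge0; lra.
  have := sum_ln_primes_le R (Num.truncn Z).
  have /andP[tZ _] := truncn_itv (ltW Z0); rewrite -/s.
  have : (Num.truncn Z)%:R * ln 4 <= Z * 2 by apply: ler_pM.
  lra.
apply: le_trans (lerD (lerD small mid) big).
rewrite [X in _ <= X + _ + _]big_mkcondr [X in _ <= _ + X + _]big_mkcondr /=.
rewrite -!big_split /= big_seq_cond [X in _ <= X]big_seq_cond.
apply: ler_sum => p /andP[/ms/andP[p0 pZ] pp].
have /andP[h0 h1] := h01 p p0.
have p0R : 0 < p%:R :> R by rewrite ltr0n.
have lp0 : 0 <= ln (p%:R : R) by rewrite ln_ge0 // ler1n.
have lpZ : ln (p%:R : R) <= ln Z by rewrite ler_ln ?posrE.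
have ip0 : 0 < (p%:R : R)^-1 by rewrite invr_gt0.
have w0 : 0 <= (1 - h p) / p%:R by rewrite divr_ge0; lra.
have iZ0 : 0 <= 4 / Z * ln (p%:R : R).
  by rewrite mulr_ge0 // divr_ge0 // ltW.
have w1 : (1 - h p) / p%:R * ln (p%:R : R) <= ln (p%:R : R) / p%:R.
  rewrite mulrAC ler_pM2r // -[X in _ <= X]mul1r ler_wpM2r //; lra.
case: (leP p%:R P) => pP /=; first lra.
case: ifP => pZ4; first by rewrite [ln Z * _]mulrC; have := ler_wpM2l w0 lpZ; lra.
have {}pZ4 : Z / 4 < p%:R by rewrite ltNge pZ4.
have : (p%:R : R)^-1 <= 4 / Z.
  rewrite -[4 / Z]invrK lef_pV2 ?posrE ?invr_gt0 ?divr_gt0 // invf_div; lra.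
move=> /(ler_wpM2l lp0); lra.
Qed.

(** For [p > P], [1 / p] is at most [ln p / (p ln P)], which reduces the sum to a Mertens-type
    bound. *)
Lemma sum_inv_primes_le (R : realType) (P Z : R) (s : seq nat) :
  1 < P -> 1 <= Z -> uniq s ->
  (forall p, p \in s -> [&& prime p, P < p%:R & p%:R <= Z]) ->
  \sum_(p <- s) (2 / p%:R) <= 4 * (ln Z / ln P).
Proof.
move=> P1 Z1 us H; have lP : 0 < ln P by exact: ln_gt0.
have : \sum_(p <- s) ln (p%:R : R) / p%:R <= 2 * ln Z.
  apply: sum_ln_primes_div_le_real => // p /H/and3P[pp _ pZ].
  by rewrite pp.
have : \sum_(p <- s) (2 / p%:R) <= 2 / ln P * \sum_(p <- s) ln (p%:R : R) / p%:R.
  rewrite mulr_sumr big_seq [X in _ <= X]big_seq; apply: ler_sum => p ps.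
  have /and3P[pp Pp _] := H p ps.
  rewrite mulrA ler_pM2r ?invr_gt0 ?ltr0n ?prime_gt0 //.
  rewrite mulrAC ler_pdivlMr // ler_pM2l // ler_ln ?posrE; lra.
move=> H1 H2; apply: le_trans H1 _.
rewrite (_ : 4 * _ = 2 / ln P * (2 * ln Z)); last by field; rewrite gt_eqF.
by rewrite ler_wpM2l // divr_ge0 // ltW.
Qed.

Lemma prod_primes_le_expR (R : realType) (Y : R) (s : seq nat) :
  0 <= Y -> uniq s -> (forall p, p \in s -> prime p && (p%:R <= Y)) ->
  (\prod_(p <- s) p)%N%:R <= expR (2 * Y).
Proof.
move=> Y0 us H; set N := Num.truncn Y.
have /andP[NY _] := truncn_itv Y0.
apply: (@le_trans _ _ (expR 2 ^+ N)); last first.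
  by rewrite -expRM_natl ler_expR mulrC ler_pM2l.
apply: (@le_trans _ _ (4 ^+ N)); last by rewrite lerXn2r ?nnegrE ?expR_ge0 //; exact: four_le_expR2.
rewrite -natrX ler_nat; apply: leq_trans (primorial_le N).
apply: dvdn_leq; first by rewrite prodn_cond_gt0 // => p /prime_gt0.
apply: prod_primes_dvdn => //; first by apply/allP => p /H/andP[].
move=> p /H/andP[pp pY]; rewrite -big_filter (big_rem p) /= ?dvdn_mulr //.
by rewrite mem_filter pp mem_index_iota prime_gt0 //= ltnS truncn_ge_nat.
Qed.

Lemma exists_power_between (R : realType) (r : nat) (X : R) :
  (1 < r)%N -> r%:R <= X ->
  exists2 m, (0 < m)%N & (r ^ m)%N%:R <= X < (r ^ m.+1)%N%:R.
Proof.
move=> r1 rX; have X0 : 0 <= X by apply: le_trans rX; rewrite ler0n.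
set n := Num.truncn X.
have rn : (r <= n)%N by rewrite truncn_ge_nat.
have n0 : (0 < n)%N by lia.
exists (trunc_log r n); first by rewrite trunc_log_gt0; lia.
have /andP[m1 m2] := trunc_log_bounds r1 n0.
have /andP[nX Xn] := truncn_itv X0.
apply/andP; split; first by apply: le_trans nX; rewrite ler_nat.
by apply: lt_le_trans Xn _; rewrite ler_nat.
Qed.

(** * Numerical inequalities between the parameters *)

Lemma expR_ge_2000 (R : realType) (t : R) : 100 <= t -> 2000 * t <= expR t.
Proof.
move=> t100; have -> : expR t = expR (t / 4) ^+ 4.
  by rewrite -expRM_natl; congr expR; field.
have H : t / 4 <= expR (t / 4) by have := expR_ge1Dx (t / 4); lra.
apply: (@le_trans _ _ ((t / 4) ^+ 4)); last by rewrite lerXn2r ?nnegrE ?expR_ge0; lra.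
have s25 : 25 <= t / 4 by lra.
have s2 : 625 <= (t / 4) ^+ 2 by rewrite expr2; nra.
have s3 : 625 * (t / 4) <= (t / 4) ^+ 3 by rewrite exprS; nra.
rewrite exprS; nra.
Qed.

(** [k] is the least integer above [(u + 1) / eta]. The number [24 k / eta] is the inverse of the
    loss per block; it is at most [2 u / eta ^ 3]. The slack [25 u] in the coefficient of the
    logarithm absorbs both the excess of [k] over [u / eta] and the term [4 / eta]. *)
Lemma block_count_bounds (R : realType) (eta u : R) (k : nat) :
  0 < eta <= 1 / 100 -> 5 / eta ^+ 2 <= u ->
  k = (Num.truncn ((u + 1) / eta)).+1 ->
  [/\ u + 1 < eta * k%:R, k%:R <= 2 * u / eta &
      k%:R * ln (24 * k%:R / eta) + 4 / eta <=
      u / eta * (1 + 25 * eta) * ln (2 * u / eta ^+ 3)].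
Proof.
move=> /andP[eta0 eta1] u1 kE.
set j := eta^-1; have j0 : 0 < j by rewrite invr_gt0.
have ej : eta * j = 1 by rewrite divff // gt_eqF.
have j100 : 100 <= j by nra.
have uj : 5 * j * j <= u by move: u1; rewrite -exprVn -/j expr2 mulrA.
have u0 : 500 * j <= u by nra.
have q0 : 0 <= (u + 1) / eta by rewrite divr_ge0; lra.
have /andP[q1 q2] := truncn_itv q0.
move: q1 q2; rewrite -kE => q1 q2.
have k1 : u + 1 < eta * k%:R by rewrite mulrC -ltr_pdivrMr.
have k2 : k%:R <= u * j + j + 1.
  by rewrite kE -natr1 lerD2r (le_trans q1) // mulrDl mul1r.
have k3 : k%:R <= 2 * (u * j) by nra.
split => //; first by rewrite -mulrA.
have k0 : 0 < k%:R :> R by rewrite kE ltr0n.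
rewrite -/j -exprVn -/j.
set Y := 2 * u * j ^+ 3.
have Yk : 24 * k%:R * j <= Y.
  apply: (@le_trans _ _ (24 * (2 * (u * j)) * j)).
    by rewrite ler_pM2r // ler_pM2l.
  have -> : Y = 2 * (u * j) * j * j by rewrite /Y; ring.
  have : 0 <= (u * j) * j by rewrite !mulr_ge0; lra.
  nra.
have kj0 : 0 < 24 * k%:R * j by rewrite !mulr_gt0.
have Y0 : 0 < Y by lra.
have lkY : ln (24 * k%:R * j) <= ln Y by rewrite ler_ln ?posrE.
have Y2 : 2 <= Y.
  apply: le_trans Yk.
  have : 1 <= k%:R :> R by rewrite kE ler1n.
  nra.
have lY : 1 / 2 <= ln Y.
  have H : Y^-1 <= 1 / 2 by rewrite div1r lef_pV2 ?posrE.
  have H0 : 0 < Y^-1 by rewrite invr_gt0.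
  have : ln (1 + (Y^-1 - 1)) <= Y^-1 - 1 by apply: le_ln1Dx; lra.
  by rewrite addrC subrK lnV ?posrE //; lra.
apply: (@le_trans _ _ ((u * j + j + 1) * ln Y + 4 * j)).
  rewrite lerD2r; apply: le_trans (ler_wpM2r _ k2); last lra.
  by rewrite ler_pM2l.
have -> : u * j * (1 + 25 * eta) = u * j + 25 * u.
  have -> : u * j * (1 + 25 * eta) = u * j + 25 * u * (eta * j) by ring.
  by rewrite ej mulr1.
nra.
Qed.

(** With [L = log log x], the number [V = (log x) ^ (eta / 2)] is at least [L ^ 2], and
    [u <= eta V]. The conclusions serve to keep the primes of the moduli above those of [S], to
    leave room for the modulus, and to make single primes light compared with a block. *)
Lemma growth_bounds (R : realType) (LL L eta u : R) :
  100 <= LL -> L = expR LL -> 0 < eta <= 1 / 100 -> 20 * LL <= eta * L ->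
  5 / eta ^+ 2 <= u -> u <= eta * expR (eta / 2 * L) ->
  [/\ L <= expR (eta * L), 8 * (u * L) <= expR L &
      12 * u <= eta ^+ 2 * expR (eta * L)].
Proof.
move=> LL1 LE /andP[eta0 eta1] etaL u1 u2.
have L0 : 0 < L by rewrite LE expR_gt0.
have LLL : 2000 * LL <= L by rewrite LE; exact: expR_ge_2000.
set V := expR (eta / 2 * L) in u2.
have VL : L ^+ 2 <= V by rewrite /V [in X in X <= _]LE -expRM_natl ler_expR; lra.
have -> : expR (eta * L) = V ^+ 2.
  by rewrite /V -expRM_natl; congr expR; field.
have VZ : V ^+ 2 <= expR L by rewrite /V -expRM_natl ler_expR; nra.
have V0 : 0 < V by exact: expR_gt0.
clearbody V.
have u0 : 0 < u by apply: lt_le_trans u1; rewrite divr_gt0 // exprn_gt0.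
have LV : 2000 * L <= V by apply: le_trans VL; rewrite expr2 ler_pM2r //; lra.
have uV : u <= V by apply: (le_trans u2); rewrite ler_piMl //; lra.
split.
- have : V * 1 <= V ^+ 2 by rewrite expr2 ler_pM2l //; lra.
  lra.
- apply: le_trans VZ; have : u * L <= V * L by rewrite ler_pM2r.
  have : V * (2000 * L) <= V ^+ 2 by rewrite expr2 ler_pM2l.
  have : 0 < V * L by rewrite mulr_gt0.
  lra.
have eV : 12 <= eta * V.
  have : eta * (2000 * L) <= eta * V by rewrite ler_pM2l.
  lra.
have : 12 * (eta * V) <= (eta * V) * (eta * V) by rewrite ler_pM2r // mulr_gt0.
have -> : eta ^+ 2 * V ^+ 2 = (eta * V) * (eta * V) by ring.
lra.
Qed.

(** * Existence of the prime power modulus and of the primes for the blocks *)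

(** Here [expR L] is [log x]. The modulus is the largest power of [r] up to [x / (log x) ^ u];
    maximality loses at most a factor [r <= log x], whence the exponent [u + 1] in the bound for
    [M]. *)
Lemma exists_power_modulus (R : realType) (L u : R) (r : nat) :
  prime r -> r%:R <= expR L -> 100 <= L -> 8 <= u -> 8 * (u * L) <= expR L ->
  exists m M : nat,
  [/\ (0 < m)%N, (r ^ m)%N%:R <= expR (expR L - u * L),
      expR (expR L) / 8 <= M%:R * (r ^ m)%N%:R <= expR (expR L) / 4 &
      M%:R < expR ((u + 1) * L)].
Proof.
move=> rp; set Z := expR L => rZ L100 u8 uL.
have ZE : Z = expR L by [].
have Z0 : 0 < Z by exact: expR_gt0.
set x := expR Z; have x0 : 0 < x by exact: expR_gt0.
have XE : expR (Z - u * L) = x / expR (u * L) by rewrite expRD expRN.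
have Z2 : expR (Z / 2) <= expR (Z - u * L) by rewrite ler_expR; lra.
(* With [Z = log x]: [r <= Z <= (Z / 4 + 1) ^ 2 <= expR (Z / 2)], so the exponent is at least 1. *)
have rX : r%:R <= expR (Z - u * L).
  apply: le_trans Z2; have -> : Z / 2 = Z / 4 + Z / 4 by field.
  rewrite expRD; have Z4 : 0 <= Z / 4 by lra.
  have Z40 : 8 <= Z by have := expR_ge1Dx L; lra.
  have H : Z / 4 + 1 <= expR (Z / 4) by have := expR_ge1Dx (Z / 4); lra.
  apply: (@le_trans _ _ ((Z / 4 + 1) * (Z / 4 + 1))); first nra.
  by apply: ler_pM => //; lra.
have [m m0 /andP[mX Xm]] := exists_power_between (prime_gt1 rp) rX.
set l := (r ^ m)%N in mX.
have l0 : 0 < l%:R :> R by rewrite ltr0n expn_gt0 prime_gt0.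
set M := Num.truncn (x / 4 / l%:R).
have [M1 M2] : M%:R * l%:R <= x / 4 /\ x / 4 < M%:R * l%:R + l%:R.
  have : 0 <= x / 4 / l%:R by rewrite ltW // !divr_gt0.
  move=> /truncn_itv/andP[]; rewrite -/M ler_pdivlMr // => -> ub; split => //.
  by move: ub; rewrite ltr_pdivrMr // -[M.+1%:R]natr1 mulrDl mul1r.
exists m, M; split => //.
  rewrite -/l M1 andbT.
  (* The integer part in [M] loses less than [l], hence at most [x / 8]. *)
  have lx : l%:R <= x / 8.
    apply: (le_trans mX); rewrite XE ler_pM2l // lef_pV2 ?posrE ?expR_gt0 //.
    have uL1 : 800 <= u * L by apply: le_trans (ler_pM _ _ u8 L100); lra.
    have := expR_ge1Dx (u * L); lra.
  lra.
rewrite -(ltr_pM2r l0); apply: le_lt_trans M1 _.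
rewrite mulrDl mul1r expRD -ZE.
have : x < expR (u * L) * (r ^ m.+1)%N%:R by rewrite mulrC -ltr_pdivrMr ?expR_gt0 -?XE.
rewrite expnS natrM -/l => H; apply: (@lt_trans _ _ x); first lra.
by apply: lt_le_trans H _; rewrite -mulrA ler_pM2l ?expR_gt0 // ler_pM2r.
Qed.

(** Dividing the split logarithmic sum by [L] leaves weight at least [eta - 8 / L >= eta / 2] on
    [(P, Z / 4]]. Setting one prime [r] aside costs at most [1 / P <= eta / 6]. *)
Lemma exists_heavy_primes (R : realType) (h : nat -> R) (L eta : R) :
  (forall n, (0 < n)%N -> 0 <= h n <= 1) -> 0 < eta -> 2000 <= eta * L ->
  6 <= eta * expR (eta * L) -> 0 < L ->
  3 * eta * L <= \sum_(1 <= p < (Num.truncn (expR L)).+1 | prime p)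
    (1 - h p) / p%:R * ln (p%:R : R) ->
  exists (r : nat) (ps : seq nat),
  [/\ uniq (r :: ps),
      forall p, p \in r :: ps -> [&& prime p, expR (eta * L) < p%:R &
        p%:R <= expR L / 4] &
      eta / 3 <= \sum_(p <- ps) (1 - h p) / p%:R].
Proof.
move=> h01 eta0 etaL etaP L0; set P := expR (eta * L); set Z := expR L => Hw.
have P1 : 1 <= P by rewrite /P -expR0 ler_expR; lra.
have Z1 : 1 <= Z by rewrite /Z -expR0 ler_expR; lra.
have W : eta / 2 <= \sum_(p <- primes_between P (Z / 4)) (1 - h p) / p%:R.
  have := le_trans Hw (sum_ln_weight_le P1 Z1 h01).
  by rewrite !expRK => H; rewrite -(ler_pM2l L0); lra.
case Eps : (primes_between P (Z / 4)) W => [|r ps] W.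
  by move: W; rewrite big_nil; lra.
have mps p : (p \in r :: ps) = [&& prime p, P < p%:R & p%:R <= Z / 4].
  by rewrite -Eps mem_primes_between //; lra.
exists r, ps; split.
- by rewrite -Eps uniq_primes_between.
- by move=> p; rewrite mps.
have : r \in r :: ps by rewrite mem_head.
rewrite mps => /and3P[rp Pr _].
have P0 : 0 < P by exact: expR_gt0.
move: W; rewrite big_cons.
have /andP[h0 h1] := h01 r (prime_gt0 rp).
have r0 : 0 < r%:R :> R by rewrite ltr0n prime_gt0.
have : (1 - h r) / r%:R <= eta / 6.
  rewrite ler_pdivrMr //; have : eta * P < eta * r%:R by rewrite ltr_pM2l.
  rewrite -/P in etaP; lra.
lra.
Qed.

(** * Contradiction from uniformly small errors *)

Theorem corollary1p3 (R : realType) :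
  exists x0 c : R, 0 < c /\
  forall x : R, x0 <= x ->
  forall (a : nat -> R) (S : {fset nat}) (h : nat -> R) (alpha : R),
    (forall n : nat, (0 < n)%N -> 0 <= a n) ->
    (forall p : nat, p \in S -> prime p) ->
    (forall p : nat, p \in S -> 1 <= (p%:R : R) <= ln (ln x)) ->
    arith_multiplicative h ->
    (forall n : nat, (0 < n)%N -> 0 <= h n <= 1) ->
    60 * ln (ln (ln x)) / ln (ln x) <= alpha ->
    alpha * ln (ln x) <=
      \sum_(1 <= p < (Num.truncn (ln x)).+1 | prime p)
        (1 - h p) / p%:R * ln (p%:R : R) ->
    let eta : R := Num.min (alpha / 3) (1 / 100) in
    forall u : R,
      5 / eta ^+ 2 <= u -> u <= eta * (ln x) `^ (eta / 2) ->
      exists (y : R) (l : nat) (b : int),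
        [/\ x / 4 < y < x,
            (0 < l)%N,
            (l%:R : R) <= x / (ln x) `^ u,
            (forall p : nat, p \in S -> ~~ (p %| l)%N) &
            c * (expR (- (u / eta * (1 + 25 * eta) * ln (2 * u / eta ^+ 3)))
                 * (summatory a x / (totient l)%:R))
            <= `| summatory_ap a y l b
                  - f_int h l b / (l%:R * gamma_ h l) * y
                    * (summatory a x / x) | ].
Proof.
(* This [x0] gives [log log log x >= 100]; [1 / 128] is half the inverse of the constant 64 of the
   matrix argument. *)
exists (expR (expR (expR 100))), (1 / 128); split; first lra.
move=> x xx0 a S h alpha a0 Sp SL hmul h01 al1 al2 eta u u1 u2.
have x0 : 0 < x by apply: lt_le_trans xx0; exact: expR_gt0.
set Z := ln x in SL al1 al2 u2 *; set L := ln Z in SL al1 al2 *.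
set LL := ln L in al1.
have Z1 : expR (expR 100) <= Z by rewrite -[X in X <= _]expRK ler_ln ?posrE ?expR_gt0.
have Z0 : 0 < Z by apply: lt_le_trans Z1; exact: expR_gt0.
have L1 : expR 100 <= L by rewrite -[X in X <= _]expRK ler_ln ?posrE ?expR_gt0.
have L0 : 0 < L by apply: lt_le_trans L1; exact: expR_gt0.
have LL1 : 100 <= LL by rewrite -[X in X <= _]expRK ler_ln ?posrE ?expR_gt0.
have xE : x = expR Z by rewrite lnK.
have ZE : Z = expR L by rewrite lnK.
have LE : L = expR LL by rewrite lnK.
have LLL : 2000 * LL <= L by rewrite LE; exact: expR_ge_2000.
have powZ t : Z `^ t = expR (t * L) by rewrite /powR gt_eqF.
rewrite powZ in u2.
clearbody LL; clearbody L; clearbody Z.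
have eta1 : eta <= 1 / 100 by rewrite ge_min lexx orbT.
have eta3 : 3 * eta <= alpha.
  have : eta <= alpha / 3 by rewrite ge_min lexx.
  lra.
(* Both terms of the minimum are at least [20 LL / L]: the first by the lower bound on [alpha], the
   second since [2000 LL <= L]. *)
have etaL : 20 * LL <= eta * L.
  rewrite -ler_pdivrMr // le_min; apply/andP; split; first lra.
  by rewrite ler_pdivrMr //; lra.
clearbody eta.
have eta0 : 0 < eta by rewrite -(pmulr_lgt0 _ L0); lra.
have etaL2 : 2000 <= eta * L by lra.
have eta01 : 0 < eta <= 1 / 100 by rewrite eta0.
have [PL uL uP] := growth_bounds LL1 LE eta01 etaL u1 u2.
have [] := block_count_bounds eta01 u1 erefl.
set k := (Num.truncn _).+1 => k1 k2 kexp.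
have kge1 : 1 <= k%:R :> R by rewrite ler1n.
have k0 : 0 < k%:R :> R by lra.
clearbody k.
have kP : 6 * k%:R <= eta * expR (eta * L).
  rewrite -(ler_pM2l eta0) [eta * (eta * _)]mulrA -expr2; apply: le_trans uP.
  by move: k2; rewrite ler_pdivlMr //; lra.
have etaP : 6 <= eta * expR (eta * L) by lra.
have al3 : 3 * eta * L <= \sum_(1 <= p < (Num.truncn (expR L)).+1 | prime p)
    (1 - h p) / p%:R * ln (p%:R : R).
  by rewrite -ZE; apply: le_trans al2; rewrite ler_pM2r.
have [r [ps [ups mps Wps]]] := exists_heavy_primes h01 eta0 etaL2 etaP L0 al3.
have aps : all prime (r :: ps) by apply/allP => p /mps /and3P[].
have u8 : 8 <= u.
  apply: le_trans u1; rewrite ler_pdivlMr ?exprn_gt0 // expr2.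
  have : eta * eta <= 1 / 100 * (1 / 100) by apply: ler_pM => //; exact: ltW.
  lra.
have L100 : 100 <= L by lra.
clear xx0 Z1 L1 LLL LL1 al1 al2 al3 eta1 eta3 etaL u1 u2 uP etaP.
have [rp rZ] : prime r /\ r%:R <= expR L.
  have /and3P[-> _ rZ] := mps r (mem_head _ _); split => //.
  by apply: le_trans rZ _; have := expR_gt0 L; lra.
have [m [M [m0 mX Ml MP]]] := exists_power_modulus rp rZ L100 u8 uL.
rewrite -ZE -xE in mX Ml.
have prodX (T : seq nat) : uniq T -> {subset T <= r :: ps} ->
    (\prod_(p <- T) p)%N%:R <= expR (Z / 2).
  move=> uT sT; rewrite (_ : Z / 2 = 2 * (Z / 4)); last by field.
  apply: prod_primes_le_expR => //; first by lra.
  by move=> p /sT/mps/and3P[-> _]; rewrite ZE.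
have xZ2 : 16 * expR (Z / 2) <= x.
  rewrite xE [in X in _ <= X](_ : Z = Z / 2 + Z / 2); last by field.
  rewrite expRD ler_pM2r ?expR_gt0 //.
  have := expR_ge1Dx (Z / 2); have := expR_ge1Dx L; lra.
have X2 : expR (Z / 2) <= expR (Z - u * L) by rewrite ler_expR; lra.
(* The interval runs from [(log x) ^ eta] to below [log x], so the ratio of logarithms is
   [1 / eta]. *)
have sumps : \sum_(p <- ps) (2 / p%:R) <= 4 / eta.
  have -> : 4 / eta = 4 * (ln Z / ln (expR (eta * L))).
    by rewrite expRK ZE expRK; field; rewrite !gt_eqF.
  apply: sum_inv_primes_le; rewrite ?ZE; [lra|by rewrite -expR0 ler_expR ltW| |].
    by move: ups => /= /andP[].
  move=> p pps; have /mps/and3P[-> -> pZ] /= : p \in r :: ps by rewrite inE pps orbT.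
  by apply: le_trans pZ _; have := expR_gt0 L; lra.
(* Chosen so that [2 k d] is exactly the available weight [eta / 3]. *)
set d := eta / (6 * k%:R).
have d4E : d / 4 = (24 * k%:R / eta)^-1 by rewrite /d; field; rewrite !gt_eqF.
have dk : 2 * k%:R * d = eta / 3 by rewrite /d; field; rewrite gt_eqF.
have d0 : 0 < d by rewrite divr_gt0 // mulr_gt0.
have Pd : (expR (eta * L))^-1 <= d <= 1.
  apply/andP; split; last by rewrite ler_pdivrMr ?mulr_gt0 //; lra.
  rewrite -[d]invrK lef_pV2 ?posrE ?expR_gt0 ?invr_gt0 // invf_div.
  by rewrite ler_pdivrMr // [X in _ <= X]mulrC.
rewrite -dk in Wps; clearbody d.
(* [M < (log x) ^ (u + 1)] while [eta k > u + 1]: no [s <= M] has [k] distinct prime factors from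
   [ps]. *)
have MPk : M%:R < expR (eta * L) ^+ k.
  apply: lt_le_trans MP _; rewrite -expRM_natl ler_expR mulrA ler_pM2r //.
  by rewrite mulrC ltW.
set E := u / eta * (1 + 25 * eta) * ln (2 * u / eta ^+ 3) in kexp *.
clearbody E.
have dE : expR (4 / eta - E) <= (d / 4) ^+ k.
  have d4 : 0 < d / 4 by lra.
  rewrite -[d / 4]lnK ?posrE // -expRM_natl ler_expR d4E.
  rewrite lnV ?posrE ?divr_gt0 ?mulr_gt0 // mulrN; lra.
have xX : x / expR (u * L) = expR (Z - u * L) by rewrite expRD expRN -xE.
apply: contrapT => nex.
set e := 1 / 128 * expR (- E).
have e0 : 0 < e by rewrite mulr_gt0 ?expR_gt0.
have D (y : R) (l : nat) (b : int) : x / 4 < y < x -> (0 < l)%N ->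
    l%:R <= expR (Z - u * L) -> (forall p : nat, p \in S -> ~~ (p %| l)%N) ->
    `|ap_error a h x y l b| < e * (summatory a x / (totient l)%:R).
  move=> yx l0 lX lS; rewrite ltNge; apply/negP => bad; apply: nex.
  by exists y, l, b; split; rewrite ?powZ ?xX // mulrA.
clear nex.
(* If [summatory a x] vanished, the strict error bound for [l = 1], [y = x / 2] would already
   fail. *)
have A0 : 0 < summatory a x.
  have X1 : 1%:R <= expR (Z - u * L).
    by apply: le_trans X2; rewrite -[X in X <= _]expR0 ler_expR ltW // divr_gt0.
  have := D (x / 2) 1%N 0 _ isT X1; rewrite (_ : totient 1 = 1%N) // divr1.
  have -> : x / 4 < x / 2 < x by clear -x0; apply/andP; split; lra.
  move=> /(_ isT) H; rewrite -(pmulr_rgt0 _ e0); apply: le_lt_trans (H _) => //.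
  by move=> p /Sp pp; rewrite Euclid_dvd1.
have osc : (d / 2) ^+ k <= 2 ^+ k * (64 * expR (\sum_(p <- ps) (2 / p%:R)) * e).
  apply: (@oscillation_bound R a h x e (expR (eta * L)) d ps r m M k) => //.
  - exact: ltW.
  - by apply: le_trans xZ2; rewrite ler_pM2l // prodX.
  - by rewrite -[X in X <= _]expR0 ler_expR ltW // mulr_gt0.
  - by move=> p pps; apply/ltW; have /mps/and3P[] : p \in r :: ps by rewrite inE pps orbT.
  move=> t Ht y b yx; apply: ltW.
  (* Primes of [S] are at most [log log x <= (log x) ^ eta], below every prime of the moduli. *)
  have SP p : p \in S -> p%:R <= expR (eta * L) by move=> /SL/andP[_ pL]; apply: le_trans PL.
  have [t0 tX tS] : [/\ (0 < t)%N, t%:R <= expR (Z - u * L) &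
      forall p, p \in S -> ~~ (p %| t)%N].
    case: Ht => [->|[T [uT sT ->]]].
      split=> //; first by rewrite expn_gt0 prime_gt0.
      move=> p pS; apply/negP; rewrite Euclid_dvdX ?dvdn_prime2 ?(Sp p pS) //.
      move=> /andP[/eqP pr _]; have := SP p pS.
      by have /and3P[_ + _] := mps r (mem_head _ _); rewrite pr leNgt => ->.
    have srT : {subset r :: T <= r :: ps}.
      by move=> p; rewrite !inE => /orP[->//|/sT ->]; rewrite orbT.
    have arT : all prime (r :: T) by apply/allP => p /srT /(allP aps).
    have urT : uniq (r :: T).
      by rewrite /= uT andbT; move: ups => /= /andP[+ _]; apply: contra => /sT.
    split; [exact: prod_primes_gt0|exact: le_trans (prodX _ urT srT) X2|].
    move=> p pS; rewrite dvdn_prod_primes ?Sp //; apply/negP => /srT/mps.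
    by move=> /and3P[_ + _]; rewrite ltNge SP.
  exact: D.
(* The constants give [64 / 128 = 1 / 2], so this bound is half of the lower bound [dE] for the same
   quantity. *)
have upper : (d / 4) ^+ k <= 1 / 2 * expR (4 / eta - E).
  have -> : d / 4 = d / 2 / 2 by field.
  rewrite expr_div_n ler_pdivrMr ?exprn_gt0 // [X in _ <= X]mulrC; apply: le_trans osc _.
  rewrite ler_pM2l ?exprn_gt0 // expRD /e.
  have : expR (\sum_(p <- ps) (2 / p%:R)) <= expR (4 / eta) by rewrite ler_expR.
  move=> /(ler_wpM2r (expR_ge0 (- E))); clear; lra.
by have := expR_gt0 (4 / eta - E); move: dE upper; clear; lra.
Qed.
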